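(* Let $(\mathbf X_1,\mathbf Y_1)$ and $(\mathbf X_2,\mathbf Y_2)$ be general correlated sources, both uniformly integrable, with identical marginals $\mathbf X_1=\mathbf X_2$ (i.e. $P_{X_1^n}=P_{X_2^n}$ for all $n$), and let $(\mathbf X,\mathbf Y)$ be their mixture $P_{X^nY^n}=\alpha_1P_{X_1^nY_1^n}+\alpha_2P_{X_2^nY_2^n}$ with $\alpha_1,\alpha_2>0$, $\alpha_1+\alpha_2=1$. Then \[\overline H_s(\mathbf X|\mathbf Y)=\lim_{\varepsilon\downarrow0}\limsup_{n\to\infty}\frac1n\sum_{x^n\in\mathcal X^n}P_{X^n}(x^n)\Big[\max_{i=1,2}\overline h_i^\varepsilon(x^n)\Big].\]
   Context: A general correlated source $\{(X^n,Y^n)\}_{n\ge1}$ is an arbitrary sequence of pairs of random variables on $\mathcal X^n\times\mathcal Y^n$, $\mathcal X,\mathcal Y$ finite or countably infinite (no structural assumptions; marginal probabilities positive). Logs base 2. A source is uniformly integrable if $Z_n=\frac1n\log\frac1{P_{X^n|Y^n}(X^n|Y^n)}$ satisfies $\lim_{u\to\infty}\sup_n\sum_{z:|z|\ge u}P_{Z_n}(z)|z|=0$. For a source with distributions $P_{X^nY^n}$, $x^n$ and $\varepsilon\in(0,1]$: $\overline h^\varepsilon(x^n|P_{X^nY^n})=\inf\{a\in\mathbb R:\sum_{y^n:\log(1/P_{X^n|Y^n}(x^n|y^n))>a}P_{Y^n|X^n}(y^n|x^n)\le\varepsilon\}$; $\overline h_i^\varepsilon(x^n)=\overline h^\varepsilon(x^n|P_{X_i^nY_i^n})$;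 $\overline H_s^\varepsilon(X^n|Y^n)=\sum_{x^n}P_{X^n}(x^n)\overline h^\varepsilon(x^n|P_{X^nY^n})$; $\overline H_s(\mathbf X|\mathbf Y)=\lim_{\varepsilon\downarrow0}\limsup_n\frac1n\overline H_s^\varepsilon(X^n|Y^n)$. *)

(* Defs.v *)
From HB Require Import structures.
From mathcomp Require Import all_boot all_order all_algebra.
From mathcomp Require Import all_classical all_reals all_analysis.
Set Implicit Arguments. Unset Strict Implicit. Unset Printing Implicit Defensive.
Import Order.TTheory GRing.Theory Num.Theory.
Local Open Scope classical_set_scope.
Local Open Scope ring_scope.

Section Defs.
Variables (R : realType) (X Y : countType).

Definition log2 (t : R) : R := ln t / ln 2.

Definition srcT := forall n : nat, n.-tuple X * n.-tuple Y -> R.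

Definition margX (P : srcT) n (x : n.-tuple X) : R :=
  fine (\esum_(y in [set: n.-tuple Y]) (P n (x, y))%:E)%E.
Definition margY (P : srcT) n (y : n.-tuple Y) : R :=
  fine (\esum_(x in [set: n.-tuple X]) (P n (x, y))%:E)%E.

Definition condXY (P : srcT) n x y : R := P n (x, y) / margY P y.
Definition condYX (P : srcT) n x y : R := P n (x, y) / margX P x.

Definition is_source (P : srcT) : Prop :=
  forall n, (forall z, 0 <= P n z) /\
    (\esum_(z in [set: n.-tuple X * n.-tuple Y]) (P n z)%:E = 1)%E /\
    (forall x : n.-tuple X, 0 < margX P x) /\ (forall y : n.-tuple Y, 0 < margY P y).

Definition Zn (P : srcT) n (w : n.-tuple X * n.-tuple Y) : R :=
  n%:R^-1 * log2 (1 / condXY P w.1 w.2).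

Definition PZ (P : srcT) n (z : R) : \bar R :=
  (\esum_(w in [set w | Zn P w = z]) (P n w)%:E)%E.

Definition tailZ (P : srcT) n (u : R) : \bar R :=
  (\esum_(z in [set z : R | (u <= `|z|)%R]) (PZ P n z * (`|z|%R)%:E))%E.

Definition unif_integrable (P : srcT) : Prop :=
  (fun u => ereal_sup [set tailZ P n u | n in [set n : nat | (0 < n)%N]])
    @ +oo --> (0 : \bar R).

Definition hbar (P : srcT) (eps : R) n (x : n.-tuple X) : \bar R :=
  ereal_inf [set a%:E | a in [set a : R |
    (\esum_(y in [set y | (a < log2 (1 / condXY P x y))%R]) (condYX P x y)%:E
       <= eps%:E)%E]].

Definition Hs_eps (P : srcT) (eps : R) n : \bar R :=
  (\esum_(x in [set: n.-tuple X]) ((margX P x)%:E * hbar P eps x))%E.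

Definition Hs (P : srcT) : \bar R :=
  lim ((fun eps : R => limn_esup (fun n => ((n%:R^-1)%:E * Hs_eps P eps n)%E))
         @ 0^'+).

Definition mixture (a1 a2 : R) (P1 P2 : srcT) : srcT :=
  fun n w => a1 * P1 n w + a2 * P2 n w.

Definition Hs_max (P P1 P2 : srcT) : \bar R :=
  lim ((fun eps : R => limn_esup (fun n => ((n%:R^-1)%:E *
     \esum_(x in [set: n.-tuple X])
        ((margX P x)%:E * Order.max (hbar P1 eps x) (hbar P2 eps x)))%E))
         @ 0^'+).

End Defs.

(* Main.v *)
(** Write Q for the mixture. If [c P <= A] pointwise for sources P, A and a
further source B, then the P-expectation of the ratio [B(x|y) / A(x|y)] is at
most [1 / c], whatever n is. Conditionally on [x], Markov's inequality therefore
bounds [log (1 / A(x|Y))] by [log (1 / B(x|Y)) + q(x)] up to P-probability [eps],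
where the expectation of [q(X)] is [O(1 / eps)], uniformly in n. Taking
[(P, A, B) = (P_i, Q, P_i)], resp. [(P_i, P_i, Q)], and using that [P_i(.|x)] is
dominated by [Q(.|x) / a_i] because the X-marginals agree, one compares the
quantile [hbar] of Q with the maximum of those of [P_1] and [P_2], at levels
differing by a constant factor and up to a shift whose mean is bounded in n. The
shift vanishes after division by n, and the constant factor vanishes as
[eps -> 0]. *)
Require Import Defs.
From HB Require Import structures.
From mathcomp Require Import all_boot all_order all_algebra.
From mathcomp Require Import all_classical all_reals all_analysis.
From mathcomp Require Import ring lra.
Import Order.TTheory GRing.Theory Num.Theory.
Local Open Scope classical_set_scope.
Local Open Scope ring_scope.

(** * Nonnegative sums, upper limits and right limits at zero in the extended reals *)

Section EsumFacts.
Set Implicit Arguments.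
Unset Strict Implicit.
Local Open Scope ereal_scope.
Variable R : realType.

Lemma ge0_esumZl (T : choiceType) (I : set T) (c : R) (f : T -> \bar R) :
  (0 <= c)%R -> (forall i, 0 <= f i) ->
  \esum_(i in I) (c%:E * f i) = c%:E * \esum_(i in I) f i.
Proof.
move=> c0 f0; rewrite /esum -ereal_supZl//; last first.
  apply/set0P; exists 0, set0; first exact: fsets_set0.
  by rewrite fsbig_set0.
congr ereal_sup; apply/seteqP; split => [_ [F FI <-]|_ [_ [F FI <-] <-]].
- by exists (\sum_(x \in F) f x) => //=; [exists F|rewrite ge0_mule_fsumr].
- by exists F => //; rewrite ge0_mule_fsumr.
Qed.

Lemma le_esum_subset (T : choiceType) (I J : set T) (f : T -> \bar R) :
  I `<=` J -> \esum_(i in I) f i <= \esum_(i in J) f i.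
Proof.
move=> IJ; apply: ereal_sup_le => _ [F [finF FI] <-].
by exists F => //; split => // x /FI /IJ.
Qed.

Lemma le_esum_term (T : choiceType) (f : T -> \bar R) (t : T) :
  (forall x, 0 <= f x) -> f t <= \esum_(x in [set: T]) f x.
Proof.
move=> f0; rewrite -[leLHS](@esum_set1 _ _ t f)//.
exact: le_esum_subset.
Qed.

Lemma esum_exchange (T U : choiceType) (f : T -> U -> \bar R) :
  (forall x y, 0 <= f x y) ->
  \esum_(x in [set: T]) \esum_(y in [set: U]) f x y =
  \esum_(y in [set: U]) \esum_(x in [set: T]) f x y.
Proof.
move=> f0; rewrite !esum_esum//.
rewrite (@reindex_esum R _ _ ([set: T] `*`` (fun=> [set: U]))
  ([set: U] `*`` (fun=> [set: T])) (fun z => (z.2, z.1)))//.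
split => [[x y]//|[x y] [x' y'] _ _ [-> ->]//|[y x] _].
by exists (x, y).
Qed.

(** Leads from the real-valued marginals back to the sums defining them: a nonnegative sum below a
    real constant is finite, so [fine] does not collapse it to a default value. *)
Lemma fine_esumK (T : choiceType) (f : T -> R) (C : R) :
  (forall x, 0 <= f x)%R -> \esum_(x in [set: T]) (f x)%:E <= C%:E ->
  (fine (\esum_(x in [set: T]) (f x)%:E))%:E = \esum_(x in [set: T]) (f x)%:E.
Proof.
move=> f0 fC; rewrite fineK// ge0_fin_numE ?(le_lt_trans fC) ?ltry//.
by apply: esum_ge0 => x _; rewrite lee_fin.
Qed.

(** An error [K / n] is eventually below any [e > 0]. So every tail set used to bound [limn_esup v]
    can be cut down to one on which [u <= v + e]. *)
Lemma limn_esup_le_perturb (u v : nat -> \bar R) (K : R) : (0 <= K)%R ->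
  (forall n, u n <= v n + (n%:R^-1 * K)%:E) -> limn_esup u <= limn_esup v.
Proof.
move=> K0 uv; apply/lee_addgt0Pr => e e0.
rewrite -leeBlDr//; apply: le_ereal_inf_tmp => _ [A [N _ NA] <-].
rewrite leeBlDr//; set B := A `&` [set n | (n%:R^-1 * K <= e)%R].
have Boo : \oo B.
  (* Beyond [truncn (K / e)] one has [K / n <= e]; the successor also forces [n > 0]. *)
  exists (maxn N (Num.truncn (K / e)).+1) => // n /=; rewrite geq_max => /andP[Nn en].
  split; first exact: NA.
  have n0 : (0 < n%:R :> R)%R by rewrite ltr0n (leq_trans _ en).
  rewrite /= mulrC ler_pdivrMr// mulrC -ler_pdivrMr//.
  by rewrite (le_trans (ltW (truncnS_gt _)))// ler_nat.
apply: (@le_trans _ _ (ereal_sup (u @` B))).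
  by apply: ereal_inf_lbound; exists B.
apply: ge_ereal_sup => _ [n [An /= ne] <-].
rewrite (le_trans (uv n))// leeD ?lee_fin//.
by apply: ereal_sup_ubound; exists n.
Qed.

Lemma limn_esup_le (u v : nat -> \bar R) :
  (forall n, u n <= v n) -> limn_esup u <= limn_esup v.
Proof.
move=> uv; apply: (@limn_esup_le_perturb _ _ 0) => // n.
by rewrite mulr0 adde0.
Qed.

(** Monotonicity turns both right limits into suprema over []0, 1[]. Since [k <= 1], the point
    [k * e] stays in that interval, so each [f e] lies below the supremum of [g]. *)
Lemma lim_at_right0_le_rescale (f g : R -> \bar R) (k : R) : (0 < k <= 1)%R ->
  {in `]0%R, 1%R[ &, {homo f : a b / (a <= b)%R >-> b <= a}} ->
  {in `]0%R, 1%R[ &, {homo g : a b / (a <= b)%R >-> b <= a}} ->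
  (forall e : R, (0 < e < 1)%R -> f e <= g (k * e)%R) ->
  lim (f @ 0^'+) <= lim (g @ 0^'+).
Proof.
move=> /andP[k0 k1] fni gni fg.
have I01 : (BRight 0%R < BLeft 1%R :> itv_bound R)%O by rewrite bnd_simp.
have /cvg_lim -> // := nonincreasing_at_right_cvge _ I01 fni.
have /cvg_lim -> // := nonincreasing_at_right_cvge _ I01 gni.
apply: ge_ereal_sup => _ [e /= e01 <-].
have /andP[e0 e1] : (0 < e < 1)%R by rewrite in_itv in e01.
rewrite (le_trans (fg e _)) ?e0//; apply: ereal_sup_ubound; exists (k * e)%R => //=.
rewrite in_itv /= mulr_gt0//= (le_lt_trans _ e1)//.
by rewrite ger_pMl.
Qed.

End EsumFacts.

(** * Marginals, conditional probabilities and conditional quantiles of one source *)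

Section SourceFacts.
Set Implicit Arguments.
Unset Strict Implicit.
Variables (R : realType) (X Y : countType).
Implicit Types P Q : srcT R X Y.

Section OneSource.
Variables (P : srcT R X Y) (n : nat).
Hypothesis srcP : is_source P.

Lemma source_ge0 z : 0 <= P (n := n) z.
Proof. by case: (srcP n). Qed.

Lemma margX_gt0 (x : n.-tuple X) : 0 < margX P x.
Proof. by case: (srcP n) => _ [_ []]. Qed.

Lemma margY_gt0 (y : n.-tuple Y) : 0 < margY P y.
Proof. by case: (srcP n) => _ [_ []]. Qed.

Lemma esum_source_rows : (\esum_(x in [set: n.-tuple X])
  \esum_(y in [set: n.-tuple Y]) (P (x, y))%:E = 1%:E)%E.
Proof.
have [P0 [P1 _]] := srcP n.
rewrite esum_esum => [|x y _ _]; last by rewrite lee_fin.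
rewrite -P1; congr esum; first by apply/seteqP; split.
by apply/funext => -[].
Qed.

Lemma esum_source_cols : (\esum_(y in [set: n.-tuple Y])
  \esum_(x in [set: n.-tuple X]) (P (x, y))%:E = 1%:E)%E.
Proof.
rewrite -esum_source_rows esum_exchange// => x y.
by rewrite lee_fin source_ge0.
Qed.

Lemma margXE (x : n.-tuple X) :
  ((margX P x)%:E = \esum_(y in [set: n.-tuple Y]) (P (x, y))%:E)%E.
Proof.
apply: (@fine_esumK _ _ _ 1) => [y|]; first exact: source_ge0.
rewrite -esum_source_rows.
apply: (@le_esum_term _ _ (fun x => \esum_(y in [set: n.-tuple Y]) (P (x, y))%:E)%E) => x'.
by apply: esum_ge0 => y _; rewrite lee_fin source_ge0.
Qed.

Lemma margYE (y : n.-tuple Y) :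
  ((margY P y)%:E = \esum_(x in [set: n.-tuple X]) (P (x, y))%:E)%E.
Proof.
apply: (@fine_esumK _ _ _ 1) => [x|]; first exact: source_ge0.
rewrite -esum_source_cols.
apply: (@le_esum_term _ _ (fun y => \esum_(x in [set: n.-tuple X]) (P (x, y))%:E)%E) => y'.
by apply: esum_ge0 => x _; rewrite lee_fin source_ge0.
Qed.

Lemma esum_margX : (\esum_(x in [set: n.-tuple X]) (margX P x)%:E = 1%:E)%E.
Proof. by rewrite -esum_source_rows; apply: eq_esum => x _; rewrite margXE. Qed.

Lemma esum_margY : (\esum_(y in [set: n.-tuple Y]) (margY P y)%:E = 1%:E)%E.
Proof. by rewrite -esum_source_cols; apply: eq_esum => x _; rewrite margYE. Qed.

Lemma condXY_ge0 (x : n.-tuple X) (y : n.-tuple Y) : 0 <= condXY P x y.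
Proof. by rewrite divr_ge0 ?source_ge0// ltW// margY_gt0. Qed.

Lemma condYX_ge0 (x : n.-tuple X) (y : n.-tuple Y) : 0 <= condYX P x y.
Proof. by rewrite divr_ge0 ?source_ge0// ltW// margX_gt0. Qed.

Lemma condXY_le1 (x : n.-tuple X) (y : n.-tuple Y) : condXY P x y <= 1.
Proof.
rewrite ler_pdivrMr ?margY_gt0// mul1r -lee_fin margYE.
apply: (@le_esum_term _ _ (fun x => (P (x, y))%:E)) => x'.
by rewrite lee_fin source_ge0.
Qed.

Lemma esum_condXY (y : n.-tuple Y) :
  (\esum_(x in [set: n.-tuple X]) (condXY P x y)%:E = 1%:E)%E.
Proof.
under eq_esum do rewrite /condXY mulrC EFinM.
rewrite ge0_esumZl -?margYE.
- by rewrite -EFinM mulVf// gt_eqF// margY_gt0.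
- by rewrite invr_ge0 ltW// margY_gt0.
- by move=> x; rewrite lee_fin source_ge0.
Qed.

Lemma esum_condYX (x : n.-tuple X) :
  (\esum_(y in [set: n.-tuple Y]) (condYX P x y)%:E = 1%:E)%E.
Proof.
under eq_esum do rewrite /condYX mulrC EFinM.
rewrite ge0_esumZl -?margXE.
- by rewrite -EFinM mulVf// gt_eqF// margX_gt0.
- by rewrite invr_ge0 ltW// margX_gt0.
- by move=> y; rewrite lee_fin source_ge0.
Qed.

Lemma log2_condXY_ge0 (x : n.-tuple X) (y : n.-tuple Y) :
  0 <= log2 (1 / condXY P x y).
Proof.
have ln2 : 0 < ln 2 :> R by apply: ln_gt0; lra.
rewrite /log2 divr_ge0 ?(ltW ln2)// div1r.
(* junk value: [log2 (1 / 0) = 0], not [+oo] *)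
have := condXY_ge0 x y; rewrite le_eqVlt => /predU1P[<-|c0].
  by rewrite invr0 ln0.
by rewrite ln_ge0// invf_ge1// condXY_le1.
Qed.

End OneSource.

(* Event defined by the posterior of [Q], probability taken under [P]. *)
Definition tail P Q n (x : n.-tuple X) (a : R) : \bar R :=
  (\esum_(y in [set y | (a < log2 (1 / condXY Q x y))%R]) (condYX P x y)%:E)%E.

Lemma hbar_le P eps n (x : n.-tuple X) (a : R) :
  (tail P P x a <= eps%:E)%E -> (hbar P eps x <= a%:E)%E.
Proof. by move=> ta; apply: ereal_inf_lbound; exists a. Qed.

Lemma tail_antitone P Q n (x : n.-tuple X) (a b : R) :
  a <= b -> (tail P Q x b <= tail P Q x a)%E.
Proof. by move=> ab; apply: le_esum_subset => y /=; exact: le_lt_trans. Qed.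

(** The strict inequality avoids asking whether the infimum is attained: some admissible level lies
    below [a], and tails are antitone. *)
Lemma hbar_lt_tail P eps n (x : n.-tuple X) (a : R) :
  (hbar P eps x < a%:E)%E -> (tail P P x a <= eps%:E)%E.
Proof.
move=> /ereal_inf_lt[_ [b tb <-]]; rewrite lte_fin => ba.
by apply: le_trans tb; apply: tail_antitone; exact: ltW.
Qed.

Lemma hbar_antitone P n (x : n.-tuple X) (e e' : R) :
  e <= e' -> (hbar P e' x <= hbar P e x)%E.
Proof.
move=> ee'; apply: le_ereal_inf => _ [a ta <-]; exists a => //=.
by apply: le_trans ta _; rewrite lee_fin.
Qed.

(** Below level 0 the tail event is everything and has conditional mass 1, so no negative level is
    admissible when [e < 1]. At [e = 1] the infimum would be [-oo]. *)
Lemma hbar_ge0 P n (x : n.-tuple X) (e : R) :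
  is_source P -> e < 1 -> (0 <= hbar P e x)%E.
Proof.
move=> srcP e1; apply: le_ereal_inf_tmp => _ [a /= ta <-].
rewrite lee_fin leNgt; apply/negP => a0.
move: ta; apply/negP; rewrite -ltNge.
rewrite [ltRHS](_ : _ = \esum_(y in [set: n.-tuple Y]) (condYX P x y)%:E)%E.
  by rewrite esum_condYX// lte_fin.
congr esum; apply/seteqP; split => // y _ /=.
by rewrite (lt_le_trans a0)// log2_condXY_ge0.
Qed.

(** Converts tail bounds at all levels above [h] into a quantile bound, with an arbitrarily small
    slack [d] above [h]; the case [h = +oo] is trivial. *)
Lemma hbar_le_addr P e n (x : n.-tuple X) (h : \bar R) (q : R) : (0 <= h)%E ->
  (forall a : R, (h < a%:E)%E -> (tail P P x (a + q)%R <= e%:E)%E) ->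
  (hbar P e x <= h + q%:E)%E.
Proof.
case: h => [h _ hq| _ _|//]; last by rewrite leey.
apply/lee_addgt0Pr => d d0.
by rewrite -!EFinD addrAC; apply/hbar_le/hq; rewrite lte_fin ltrDl.
Qed.

End SourceFacts.

(** * Replacing one posterior by another inside a tail event *)

Section ChangeOfSource.
Set Implicit Arguments.
Unset Strict Implicit.
Variables (R : realType) (X Y : countType).
Implicit Types P A B Q : srcT R X Y.

Lemma ln2_gt0 : 0 < ln 2 :> R.
Proof. by apply: ln_gt0; lra. Qed.

(** The gap gives [q * ln 2 < ln (v / u)], and [ln t < t] makes it a linear condition on the ratio,
    so a first-moment bound suffices. *)
Lemma lt_log2_ratio (u v q : R) : 0 < u -> 0 < v ->
  log2 (1 / v) + q < log2 (1 / u) -> q * ln 2 < v / u.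
Proof.
move=> u0 v0; rewrite /log2 !div1r !lnV ?posrE// -ltrBrDl -mulrBl.
rewrite ltr_pdivlMr ?ln2_gt0// => /lt_trans; apply.
by rewrite opprK addrC -ln_div ?posrE// ln_sublinear// divr_gt0.
Qed.

(* [s x y] dominates [P (x, y) * (condXY B x y / condXY A x y)] by [c P <= A],
   and its total mass is [c^-1]. The [+ 1] in [q] only serves to keep [q > 0]. *)
Lemma tail_change P A B (c d eps : R) n :
  is_source P -> is_source A -> is_source B -> 0 < c -> 0 < d -> 0 < eps ->
  (forall z, c * P n z <= A n z) -> (forall z, d * P n z <= B n z) ->
  exists q : n.-tuple X -> R, [/\ forall x, 0 <= q x,
    (\esum_(x in [set: n.-tuple X]) (margX P x * q x)%:E
       <= ((c^-1 + 1) / (eps * ln 2))%:E)%E &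
    forall x a, (tail P A x (a + q x)%R <= tail P B x a + eps%:E)%E].
Proof.
move=> sP sA sB c0 d0 eps0 cPA dPB.
have l0 := ln2_gt0.
pose s (x : n.-tuple X) (y : n.-tuple Y) := c^-1 * (margY A y * condXY B x y).
have ci0 : 0 <= c^-1 by rewrite invr_ge0 ltW.
have mA0 y : 0 <= margY A y by exact/ltW/margY_gt0.
have s0 x y : 0 <= s x y.
  by apply: mulr_ge0 => //; apply: mulr_ge0 => //; exact: condXY_ge0.
have sumS : (\esum_(x in [set: n.-tuple X]) \esum_(y in [set: n.-tuple Y])
    (s x y)%:E = (c^-1)%:E)%E.
  rewrite esum_exchange; last by move=> x y; rewrite lee_fin.
  under eq_esum => y _.
    under eq_esum do rewrite /s mulrA EFinM.
    rewrite ge0_esumZl; last 2 first.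
    - by rewrite mulr_ge0 ?ci0 ?mA0.
    - by move=> x; rewrite lee_fin condXY_ge0.
    rewrite esum_condXY// mule1 EFinM; over.
  rewrite ge0_esumZl ?esum_margY ?mule1// => y.
  by rewrite lee_fin.
pose S x := fine (\esum_(y in [set: n.-tuple Y]) (s x y)%:E)%E.
have SE x : ((S x)%:E = \esum_(y in [set: n.-tuple Y]) (s x y)%:E)%E.
  apply: (@fine_esumK _ _ _ c^-1) => //; rewrite -sumS.
  apply: (@le_esum_term _ _ (fun x => \esum_(y in [set: n.-tuple Y]) (s x y)%:E)%E).
  by move=> x'; apply: esum_ge0 => y _; rewrite lee_fin.
have S0 x : 0 <= S x.
  by rewrite -lee_fin SE; apply: esum_ge0 => y _; rewrite lee_fin.
have M0 x := margX_gt0 sP x.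
have k0 : 0 < eps * ln 2 by rewrite mulr_gt0.
(* [S x / margX P x] bounds the conditional mean of the ratio given [x]; dividing by [eps * ln 2]
   gives the Markov threshold for probability [eps]. *)
pose q x := (S x / margX P x + 1) / (eps * ln 2).
have q0 x : 0 < q x.
  by rewrite divr_gt0// ltr_wpDl// divr_ge0// ltW.
exists q; split => [x||x a]; first exact: ltW.
  (* The weight [margX P x] cancels the conditional normalisation, leaving the masses [c^-1] of [s]
     and 1 of the marginal. *)
  rewrite (@eq_esum _ _ _ _
    (fun x => ((eps * ln 2)^-1)%:E * ((S x)%:E + (margX P x)%:E))%E); last first.
    move=> x _; rewrite -EFinD -EFinM; congr EFin.
    by rewrite /q; field; rewrite !gt_eqF//= M0.
  rewrite ge0_esumZl ?invr_ge0 ?(ltW k0)//; last first.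
    by move=> x; rewrite -EFinD lee_fin addr_ge0// ltW.
  rewrite esumD => [|x _|x _]; last 2 first.
  - by rewrite lee_fin.
  - by rewrite lee_fin ltW.
  rewrite esum_margX// (eq_esum (fun x _ => SE x)) sumS.
  by rewrite -EFinD -EFinM mulrC.
(* Markov's inequality in pointwise form: [w y] is the bound on the conditional ratio divided by the
   threshold [q x * ln 2]. It will dominate [condYX P x y] wherever the A-event holds and the
   B-event fails. *)
pose w y := s x y / (margX P x * (q x * ln 2)).
have D0 : 0 < margX P x * (q x * ln 2) by apply: mulr_gt0 => //; exact: mulr_gt0.
have w0 y : 0 <= w y by rewrite divr_ge0// ltW.
have sumw : (\esum_(y in [set: n.-tuple Y]) (w y)%:E <= eps%:E)%E.
  under eq_esum do rewrite /w mulrC EFinM.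
  rewrite ge0_esumZl ?invr_ge0 ?(ltW D0)//; last by move=> y; rewrite lee_fin.
  rewrite -SE -EFinM lee_fin mulrC ler_pdivrMr//.
  rewrite (_ : eps * _ = S x + margX P x); last first.
    by rewrite /q; field; rewrite !gt_eqF//= M0.
  by rewrite lerDl ltW.
apply: (@le_trans _ _ (tail P B x a + \esum_(y in [set: n.-tuple Y]) (w y)%:E)%E);
  last by rewrite leeD2l.
rewrite /tail esum_mkcond [X in (_ <= X + _)%E]esum_mkcond -esumD; last 2 first.
- by move=> y _; case: ifP => // _; rewrite lee_fin condYX_ge0.
- by move=> y _; rewrite lee_fin.
apply: le_esum => y _.
have wE : (0 <= (w y)%:E)%E by rewrite lee_fin.
case: ifPn => [|_]; last first.
  by rewrite adde_ge0//; case: ifP => // _; rewrite lee_fin condYX_ge0.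
rewrite inE /= => aqA; case: ifPn => [|]; first by rewrite leeDl.
rewrite notin_setE /= => /negP; rewrite -leNgt => Ba; rewrite add0e lee_fin.
(* If [P (x, y) = 0] the term vanishes. Otherwise [cPA] and [dPB] make both posteriors positive, so
   the value of [log2 (1 / 0)] never interferes. *)
have := source_ge0 sP (x, y); rewrite le_eqVlt => /predU1P[P0|Pxy].
  by rewrite /condYX -P0 mul0r.
have Axy : 0 < A n (x, y) by apply: lt_le_trans (cPA _); rewrite mulr_gt0.
have Bxy : 0 < B n (x, y) by apply: lt_le_trans (dPB _); rewrite mulr_gt0.
have cA : 0 < condXY A x y by rewrite divr_gt0// margY_gt0.
have cB : 0 < condXY B x y by rewrite divr_gt0// margY_gt0.
have /(lt_log2_ratio cA cB) : log2 (1 / condXY B x y) + q x < log2 (1 / condXY A x y).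
  by apply: le_lt_trans aqA; rewrite lerD2r.
move=> qBA.
suff Ps : P n (x, y) * (q x * ln 2) <= s x y.
  rewrite /w /condYX ler_pdivlMr// [leLHS](_ : _ = P n (x, y) * (q x * ln 2))//.
  by field; rewrite gt_eqF.
apply: (@le_trans _ _ (c^-1 * A n (x, y) * (q x * ln 2))).
  rewrite ler_wpM2r ?(ltW (mulr_gt0 (q0 x) l0))// mulrC ler_pdivlMr// mulrC.
  exact: cPA.
rewrite /s -mulrA ler_wpM2l//.
(* Writing [A (x, y)] as posterior times Y-marginal reduces the claim to the ratio bound [qBA]. *)
rewrite -[A n (x, y)](@divfK _ (margY A y)) ?gt_eqF ?margY_gt0// mulrAC mulrC.
rewrite ler_wpM2l ?(ltW (margY_gt0 sA y))// mulrC -ler_pdivlMr//.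
exact: ltW.
Qed.

End ChangeOfSource.

(** * The mixture of two sources with a common X-marginal *)

Section Mixture.
Set Implicit Arguments.
Unset Strict Implicit.
Variables (R : realType) (X Y : countType) (P1 P2 : srcT R X Y) (a1 a2 : R).
Hypotheses (sP1 : is_source P1) (sP2 : is_source P2).
Hypothesis eqX : forall n (x : n.-tuple X), margX P1 x = margX P2 x.
Hypotheses (a1_gt0 : 0 < a1) (a2_gt0 : 0 < a2) (a12 : a1 + a2 = 1).
Notation Q := (mixture a1 a2 P1 P2).

Lemma esum_mixture (T : choiceType) (D : set T) (f1 f2 : T -> R) :
  (forall t, 0 <= f1 t) -> (forall t, 0 <= f2 t) ->
  (\esum_(t in D) (a1 * f1 t + a2 * f2 t)%:E =
   a1%:E * (\esum_(t in D) (f1 t)%:E) + a2%:E * (\esum_(t in D) (f2 t)%:E))%E.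
Proof.
move=> f10 f20; under eq_esum do rewrite EFinD !EFinM.
rewrite esumD => [|t _|t _]; last 2 first.
- by rewrite -EFinM lee_fin mulr_ge0// ltW.
- by rewrite -EFinM lee_fin mulr_ge0// ltW.
by rewrite !ge0_esumZl ?ltW// => t; rewrite lee_fin.
Qed.

Lemma margX_mixture n (x : n.-tuple X) : margX Q x = margX P1 x.
Proof.
rewrite {1}/margX esum_mixture => [|y|y]; [|exact: source_ge0..].
by rewrite -!margXE// -eqX -!EFinM -EFinD /= -mulrDl a12 mul1r.
Qed.

Lemma margY_mixture n (y : n.-tuple Y) :
  margY Q y = a1 * margY P1 y + a2 * margY P2 y.
Proof.
rewrite {1}/margY esum_mixture => [|x|x]; [|exact: source_ge0..].
by rewrite -!margYE.
Qed.

Lemma mixture_source : is_source Q.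
Proof.
move=> n; have [P10 [P11 _]] := sP1 n; have [P20 [P21 _]] := sP2 n.
split; first by move=> z; rewrite addr_ge0// mulr_ge0// ltW.
split; first by rewrite esum_mixture// P11 P21 !mule1 -EFinD a12.
split=> [x|y]; first by rewrite margX_mixture margX_gt0.
by rewrite margY_mixture addr_gt0// mulr_gt0// margY_gt0.
Qed.

Lemma condYX_mixture n (x : n.-tuple X) (y : n.-tuple Y) :
  condYX Q x y = a1 * condYX P1 x y + a2 * condYX P2 x y.
Proof. by rewrite /condYX margX_mixture -eqX /mixture mulrDl !mulrA. Qed.

Lemma tail_mixture B n (x : n.-tuple X) (a : R) :
  (tail Q B x a = a1%:E * tail P1 B x a + a2%:E * tail P2 B x a)%E.
Proof.
rewrite /tail; under eq_esum do rewrite condYX_mixture.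
by rewrite esum_mixture => // y; exact: condYX_ge0.
Qed.

Lemma tail_ge0 P B n (x : n.-tuple X) (a : R) :
  is_source P -> (0 <= @tail R X Y P B n x a)%E.
Proof. by move=> sP; apply: esum_ge0 => y _; rewrite lee_fin condYX_ge0. Qed.

Lemma mixture_ge1 n z : a1 * @P1 n z <= Q z.
Proof. by rewrite lerDl mulr_ge0 ?source_ge0// ltW. Qed.

Lemma mixture_ge2 n z : a2 * @P2 n z <= Q z.
Proof. by rewrite lerDr mulr_ge0 ?source_ge0// ltW. Qed.

Lemma a1_lt1 : a1 < 1. Proof. by rewrite -a12 ltrDl. Qed.
Lemma a2_lt1 : a2 < 1. Proof. by rewrite -a12 ltrDr. Qed.

(** Averages a pointwise quantile comparison over [x]. Both shifts are weighted by [margX P1]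
    because this is also the X-marginal of the mixture. *)
Lemma esum_le_shift n (h h' : n.-tuple X -> \bar R) (q1 q2 : n.-tuple X -> R)
    (K : R) :
  (forall x, 0 <= h x)%E -> (forall x, 0 <= q1 x) -> (forall x, 0 <= q2 x) ->
  (forall x, h' x <= h x + (q1 x + q2 x)%:E)%E ->
  (\esum_(x in [set: n.-tuple X]) (margX P1 x * q1 x)%:E <= K%:E)%E ->
  (\esum_(x in [set: n.-tuple X]) (margX P1 x * q2 x)%:E <= K%:E)%E ->
  (\esum_(x in [set: n.-tuple X]) ((margX Q x)%:E * h' x) <=
   \esum_(x in [set: n.-tuple X]) ((margX Q x)%:E * h x) + (K + K)%:E)%E.
Proof.
move=> h0 q10 q20 hh qK1 qK2; rewrite EFinD.
apply: le_trans (leeD2l _ (leeD qK1 qK2)).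
have M0 x := ltW (margX_gt0 sP1 x).
have m10 x : (0 <= (margX P1 x * q1 x)%:E)%E by rewrite lee_fin mulr_ge0.
have m20 x : (0 <= (margX P1 x * q2 x)%:E)%E by rewrite lee_fin mulr_ge0.
rewrite -esumD// -esumD => [|x _|x _]; last 2 first.
- by rewrite margX_mixture mule_ge0 ?lee_fin.
- by rewrite adde_ge0.
apply: le_esum => x _; rewrite margX_mixture -EFinD -mulrDr EFinM.
by rewrite -ge0_muleDr ?lee_fin ?addr_ge0// lee_wpmul2l// lee_fin.
Qed.

(** The mixture tail contains [a1 * tail P1], so [tail P1 <= a2 * e <= e]. The symmetric factor
    [a1 * a2] lets a single level serve both components. *)
Lemma tail_component1 B n (x : n.-tuple X) (a e : R) :
  (tail Q B x a <= (a1 * a2 * e)%:E)%E -> 0 < e -> (tail P1 B x a <= e%:E)%E.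
Proof.
rewrite tail_mixture => tQ e0; rewrite -(@lee_pmul2l _ a1%:E)// -EFinM.
apply: (@le_trans _ _ (a1 * a2 * e)%:E).
  by apply: le_trans tQ; rewrite leeDl// mule_ge0 ?lee_fin ?(ltW a2_gt0)// tail_ge0.
by rewrite lee_fin -mulrA ler_pM2l// ger_pMl// ltW// a2_lt1.
Qed.

Lemma tail_component2 B n (x : n.-tuple X) (a e : R) :
  (tail Q B x a <= (a1 * a2 * e)%:E)%E -> 0 < e -> (tail P2 B x a <= e%:E)%E.
Proof.
rewrite tail_mixture => tQ e0; rewrite -(@lee_pmul2l _ a2%:E)// -EFinM.
apply: (@le_trans _ _ (a1 * a2 * e)%:E).
  by apply: le_trans tQ; rewrite leeDr// mule_ge0 ?lee_fin ?(ltW a1_gt0)// tail_ge0.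
by rewrite lee_fin mulrAC mulrC ler_pM2l// ger_pMl// ltW// a1_lt1.
Qed.

(** * Two-sided comparison of the averaged quantiles at fixed level *)

Definition Hmax_eps (eps : R) n : \bar R :=
  (\esum_(x in [set: n.-tuple X])
    ((margX Q x)%:E * Order.max (hbar P1 eps x) (hbar P2 eps x)))%E.

(** Half of [e] pays for the component quantiles, half for Markov's inequality. Above the maximum
    both component tails are small, hence so is their convex combination. *)
Lemma Hs_eps_le_Hmax_eps e : 0 < e -> e < 1 -> exists2 K : R, 0 <= K &
  forall n, (Hs_eps Q e n <= Hmax_eps (e / 2) n + K%:E)%E.
Proof.
move=> e0 e1; set d := e / 2; have d0 : 0 < d by rewrite /d; lra.
have sQ := mixture_source.
pose k (a : R) := (a^-1 + 1) / (d * ln 2).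
have k0 a : 0 < a -> 0 <= k a.
  by move=> a0; rewrite divr_ge0 ?addr_ge0 ?invr_ge0 ?mulr_ge0// ltW// ln2_gt0.
(* [k a1 + k a2] bounds the mean of either shift; averaging their sum doubles it. It depends on [e]
   but not on [n]. *)
exists (k a1 + k a2 + (k a1 + k a2)); first by rewrite !addr_ge0 ?k0.
move=> n.
have p1 z : 1 * @P1 n z <= @P1 n z by rewrite mul1r.
have p2 z : 1 * @P2 n z <= @P2 n z by rewrite mul1r.
have [q1 [q10 q1K q1t]] :=
  tail_change sP1 sQ sP1 a1_gt0 ltr01 d0 (@mixture_ge1 n) p1.
have [q2 [q20 q2K q2t]] :=
  tail_change sP2 sQ sP2 a2_gt0 ltr01 d0 (@mixture_ge2 n) p2.
have h0 (P : srcT R X Y) (x : n.-tuple X) : is_source P -> (0 <= hbar P d x)%E.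
  by move=> sP; apply: hbar_ge0 => //; rewrite /d; lra.
apply: (esum_le_shift (q1 := q1) (q2 := q2)) => // [x|x||].
- by rewrite le_max h0.
- apply: hbar_le_addr => [|a]; first by rewrite le_max h0.
  rewrite gt_max => /andP[/hbar_lt_tail t1 /hbar_lt_tail t2].
  have T1 : (tail P1 Q x (a + (q1 x + q2 x)) <= e%:E)%E.
    apply: (@le_trans _ _ (tail P1 Q x (a + q1 x))).
      by apply: tail_antitone; rewrite lerD2l lerDl.
    apply: le_trans (q1t x a) _; apply: le_trans (leeD2r _ t1) _.
    by rewrite -EFinD lee_fin /d; lra.
  have T2 : (tail P2 Q x (a + (q1 x + q2 x)) <= e%:E)%E.
    apply: (@le_trans _ _ (tail P2 Q x (a + q2 x))).
      by apply: tail_antitone; rewrite lerD2l lerDr.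
    apply: le_trans (q2t x a) _; apply: le_trans (leeD2r _ t2) _.
    by rewrite -EFinD lee_fin /d; lra.
  rewrite tail_mixture [e in leRHS](_ : e = a1 * e + a2 * e); last first.
    by rewrite -mulrDl a12 mul1r.
  by rewrite EFinD !EFinM leeD// lee_wpmul2l// lee_fin ltW.
- by apply: le_trans q1K _; rewrite lee_fin lerDl k0.
- under eq_esum do rewrite eqX.
  by apply: le_trans q2K _; rewrite lee_fin lerDr k0.
Qed.

(** A mixture tail of at most [a1 * a2 * (e / 2)] leaves each component at most [e / 2]. Passing
    from the posterior of the mixture to that of the component costs the other [e / 2]. *)
Lemma Hmax_eps_le_Hs_eps e : 0 < e -> e < 1 -> exists2 K : R, 0 <= K &
  forall n, (Hmax_eps e n <= Hs_eps Q (a1 * a2 * (e / 2))%R n + K%:E)%E.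
Proof.
move=> e0 e1; set d := e / 2; have d0 : 0 < d by rewrite /d; lra.
have sQ := mixture_source.
pose k : R := (1^-1 + 1) / (d * ln 2).
have k0 : 0 <= k.
  by rewrite divr_ge0 ?addr_ge0 ?invr_ge0 ?mulr_ge0// ltW// ln2_gt0.
exists (k + k); first by rewrite addr_ge0.
move=> n.
have p1 z : 1 * @P1 n z <= @P1 n z by rewrite mul1r.
have p2 z : 1 * @P2 n z <= @P2 n z by rewrite mul1r.
have [q1 [q10 q1K q1t]] :=
  tail_change sP1 sP1 sQ ltr01 a1_gt0 d0 p1 (@mixture_ge1 n).
have [q2 [q20 q2K q2t]] :=
  tail_change sP2 sP2 sQ ltr01 a2_gt0 d0 p2 (@mixture_ge2 n).
have h0 (x : n.-tuple X) : (0 <= hbar Q (a1 * a2 * d) x)%E.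
  apply: hbar_ge0 => //; rewrite (@lt_trans _ _ d)//; last by rewrite /d; lra.
  by rewrite gtr_pMl// mulr_ilt1 ?a1_lt1 ?a2_lt1// ltW.
apply: (esum_le_shift (q1 := q1) (q2 := q2)) => // [x|].
  rewrite ge_max; apply/andP; split; apply: hbar_le_addr => // a /hbar_lt_tail tQ.
    apply: (@le_trans _ _ (tail P1 P1 x (a + q1 x))).
      by apply: tail_antitone; rewrite lerD2l lerDl.
    apply: le_trans (q1t x a) _.
    apply: le_trans (leeD2r _ (tail_component1 tQ d0)) _.
    by rewrite -EFinD lee_fin /d; lra.
  apply: (@le_trans _ _ (tail P2 P2 x (a + q2 x))).
    by apply: tail_antitone; rewrite lerD2l lerDr.
  apply: le_trans (q2t x a) _.
  apply: le_trans (leeD2r _ (tail_component2 tQ d0)) _.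
  by rewrite -EFinD lee_fin /d; lra.
by under eq_esum do rewrite eqX.
Qed.

(** * Normalisation by [n] and passage to the limit in the level *)

Lemma limn_esup_scale_le (u v : nat -> \bar R) (K : R) : 0 <= K ->
  (forall n, 0 <= v n)%E -> (forall n, u n <= v n + K%:E)%E ->
  (limn_esup (fun n => (n%:R^-1)%:E * u n) <=
   limn_esup (fun n => (n%:R^-1)%:E * v n))%E.
Proof.
move=> K0 v0 uv; apply: (@limn_esup_le_perturb _ _ _ K) => // n.
rewrite EFinM -ge0_muleDr ?lee_fin//.
by rewrite lee_wpmul2l// lee_fin invr_ge0.
Qed.

Lemma Hs_eps_ge0 e n : e < 1 -> (0 <= Hs_eps Q e n)%E.
Proof.
move=> e1; have sQ := mixture_source; apply: esum_ge0 => x _.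
by rewrite mule_ge0 ?hbar_ge0// lee_fin ltW// margX_gt0.
Qed.

Lemma Hmax_eps_ge0 e n : e < 1 -> (0 <= Hmax_eps e n)%E.
Proof.
move=> e1; have sQ := mixture_source; apply: esum_ge0 => x _.
by rewrite mule_ge0 ?le_max ?hbar_ge0// lee_fin ltW// margX_gt0.
Qed.

Lemma Hs_eps_antitone e e' n : e <= e' -> (Hs_eps Q e' n <= Hs_eps Q e n)%E.
Proof.
move=> ee; have sQ := mixture_source; apply: le_esum => x _.
by rewrite lee_wpmul2l ?hbar_antitone// lee_fin ltW// margX_gt0.
Qed.

Lemma Hmax_eps_antitone e e' n : e <= e' -> (Hmax_eps e' n <= Hmax_eps e n)%E.
Proof.
move=> ee; have sQ := mixture_source; apply: le_esum => x _.
rewrite lee_wpmul2l//; first by rewrite lee_fin ltW// margX_gt0.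
by rewrite ge_max !le_max !hbar_antitone ?orbT.
Qed.

Lemma Hs_mixture : Hs Q = Hs_max Q P1 P2.
Proof.
have antitone (F : R -> nat -> \bar R) :
    (forall e e' n, e <= e' -> (F e' n <= F e n)%E) ->
    {in `]0%R, 1%R[ &, {homo
      (fun e => limn_esup (fun n => (n%:R^-1)%:E * F e n)%E) :
      a b / (a <= b)%R >-> (b <= a)%E}}.
  move=> FA e e' _ _ ee; apply: limn_esup_le => n.
  by rewrite lee_wpmul2l ?FA// lee_fin invr_ge0.
have HsA := antitone _ Hs_eps_antitone.
have HmA := antitone _ Hmax_eps_antitone.
have a1a2 : a1 * a2 < 1 by rewrite mulr_ilt1 ?a1_lt1 ?a2_lt1// ltW.
apply/eqP; rewrite eq_le; apply/andP; split.
  (* The rescaling factors, [1 / 2] here and [a1 * a2 / 2] below, are the level losses of the two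
     comparisons. *)
  apply: (@lim_at_right0_le_rescale _ _ _ 2^-1) => //; first by lra.
  move=> e /andP[e0 e1]; have [K K0 HK] := Hs_eps_le_Hmax_eps e0 e1.
  rewrite mulrC; apply: (limn_esup_scale_le K0) => // n.
  by apply: Hmax_eps_ge0; lra.
apply: (@lim_at_right0_le_rescale _ _ _ (a1 * a2 / 2)) => //.
  by have : 0 < a1 * a2 by [exact: mulr_gt0]; lra.
move=> e /andP[e0 e1]; have [K K0 HK] := Hmax_eps_le_Hs_eps e0 e1.
rewrite mulrAC -mulrA; apply: (limn_esup_scale_le K0) => // n.
apply: Hs_eps_ge0; rewrite (@lt_trans _ _ (e / 2))//; last lra.
by rewrite gtr_pMl//; lra.
Qed.

End Mixture.

Theorem theorem13 (R : realType) (X Y : countType)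
    (P1 P2 : srcT R X Y) (a1 a2 : R) :
  is_source P1 -> is_source P2 ->
  unif_integrable P1 -> unif_integrable P2 ->
  (forall n (x : n.-tuple X), margX P1 x = margX P2 x) ->
  0 < a1 -> 0 < a2 -> a1 + a2 = 1 ->
  Hs (mixture a1 a2 P1 P2) = Hs_max (mixture a1 a2 P1 P2) P1 P2.
Proof.
by move=> sP1 sP2 _ _ eqX a1_gt0 a2_gt0 a12; exact: Hs_mixture.
Qed.
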